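(* Let $X_1,\ldots,X_I$ and $Y_1,\ldots,Y_J$ be Banach spaces and denote $X=\oplus_{i=1}^IX_i$ and $Y=\oplus_{j=1}^JY_j$. Suppose that $\mathbb{B}_{X^*}$ is sequentially weak$^*$ compact and that $0\in D\subset X^*$. Let $T\colon D\to Y^*$ be a (not necessarily linear) map. Assume: (1) $T\colon D\to Y^*$ has a weak$^*$-to-weak$^*$ closed graph: if $u_k\overset{*}{\rightharpoonup}u$ (with $u_k,u\in D$) and $Tu_k\overset{*}{\rightharpoonup}f$, then $Tu=f$. (2) For $\lambda>0$ there exist bijections $\tau_\lambda^D\colon D\to D$ and $\tau_\lambda^{Y^*}\colon Y^*\to Y^*$ such that, for all $\lambda>0$, $$T\circ\tau_\lambda^D=\tau_\lambda^{Y^*}\circ T,$$ $$\|(\tau_\lambda^Du)_i\|_{X_i^*}=\lambda^{r_i}\|u_i\|_{X_i^*}\quad\text{for }i=1,\ldots,I,\ u\in D,$$ $$\|(\tau_\lambda^{Y^*}f)_j\|_{Y_j^*}=\lambda^{s_j}\|f_j\|_{Y_j^*}\quad\text{for }j=1,\ldots,J,\ f\in Y^*,$$ where $0<r_1\le\cdots\le r_I$ and $0<s_1\le\cdots\le s_J$. (3) There exist sequences of isometric bijections $\sigma_k^D\colon D\to D$ with $\sigma_k^D(0)=0$ and isometric isomorphisms $\sigma_k^{Y^*}\colon Y^*\to Y^*$ ($k\in\mathbb{N}$) such that $T\circ\sigma_k^D=\sigma_k^{Y^*}\circ T$ for all $k\in\mathbb{N}$ and $\sigma_k^{Y^*}f\overset{*}{\rightharpoonup}0$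 as $k\to\infty$ for all $f\in Y^*$. (4) For $\ell\in\mathbb{N}$ the sets $D_\ell=\{u\in D:\|u\|_{X^*}\le\ell,\ \|Tu\|_{Y^*}\le\ell\}$ are weakly$^*$ sequentially closed in $X^*$. Then the following conditions are equivalent: (i) $T(D)$ is non-meagre in $Y^*$. (ii) $T(D)=Y^*$. (iii) $T$ is open at the origin. (iv) There is a constant $C$ such that for every $f\in Y^*$ there exists $u\in D$ with $Tu=f$ and $$\begin{cases}\sum_{i=1}^I\|u_i\|_{X_i^*}^{s_J/r_i}\le C\|f\|_{Y^*},&\text{if }\|f\|_{Y^*}\le1,\\[2pt]\sum_{i=1}^I\|u_i\|_{X_i^*}^{s_1/r_i}\le C\|f\|_{Y^*},&\text{if }\|f\|_{Y^*}>1.\end{cases}$$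
   Context: Direct sums are normed by $\|w\|_X=\sum_i\|w_i\|_{X_i}$ (similarly for $Y$), so that $X^*=\oplus_iX_i^*$ carries the norm $\|u\|_{X^*}=\max_i\|u_i\|_{X_i^*}$ (similarly for $Y^*$). $\mathbb{B}_Z$ denotes the unit ball of $Z$. Weak$^*$ topologies are those induced by the preduals $X$ and $Y$. Isometric bijections of $D$ are with respect to the metric induced by $\|\cdot\|_{X^*}$; isometric isomorphisms are linear. $T$ is open at the origin if for every $\varepsilon>0$ there is $\delta>0$ with $\delta\mathbb{B}_{Y^*}\subset T(D\cap\varepsilon\mathbb{B}_{X^*})$ (the assumptions imply $T(0)=0$). *)

(* Defs.v *)
From HB Require Import structures.
From mathcomp Require Import all_boot all_order all_algebra.
From mathcomp Require Import all_classical all_reals all_analysis.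

Set Implicit Arguments.
Unset Strict Implicit.
Unset Printing Implicit Defensive.
Import Order.TTheory GRing.Theory Num.Theory.
Import numFieldNormedType.Exports.
Local Open Scope classical_set_scope.
Local Open Scope ring_scope.

Definition nowhere_dense (S : topologicalType) (A : set S) :=
  interior (closure A) = set0.

Definition meagre (S : topologicalType) (A : set S) :=
  exists F : nat -> set S,
    (forall n, nowhere_dense (F n)) /\ A = \bigcup_n F n.

Definition seq_compact (S : topologicalType) (A : set S) :=
  forall u : nat -> S, (forall k, A (u k)) ->
  exists (phi : nat -> nat) (l : S),
    [/\ {homo phi : i j / (i < j)%N}, A l & (u \o phi) @ \oo --> l].

Definition seq_closed (S : topologicalType) (A : set S) :=
  forall (u : nat -> S) (l : S), (forall k, A (u k)) -> u @ \oo --> l -> A l.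

Arguments seq_compact : clear implicits.
Arguments seq_closed : clear implicits.

Definition unit_ball (R : realType) (V : normedModType R) : set V :=
  [set v | `|v| <= 1].

Arguments unit_ball {R} V.

Section dual_space.
Context {R : realType} (V : normedModType R).

Definition dual_pred : {pred V -> R^o} :=
  fun f => `[< linear f /\ continuous f >].

Fact dual_pred_submod : subsemimod_closed dual_pred.
Proof.
split; [split|].
- apply/asboolP; split; first by move=> a x y; rewrite /= scaler0 addr0.
  by move=> x; exact: cvg_cst.
- move=> f g /asboolP[lf cf] /asboolP[lg cg]; apply/asboolP; split.
    by move=> b x y; rewrite !fctE lf lg !scalerDr addrACA.
  by move=> x; apply: cvgD; [exact: cf|exact: cg].
- move=> a f /asboolP[lf cf]; apply/asboolP; split.
    by move=> b x y; rewrite !fctE lf !scalerDr !scalerA (mulrC a b).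
  by move=> x; apply: cvgZl_tmp; exact: cf.
Qed.

HB.instance Definition _ :=
  GRing.isSubmodClosed.Build R (V -> R^o) dual_pred dual_pred_submod.

Record dual := Dual {
  dual_fun :> V -> R^o;
  dual_funP : dual_fun \in dual_pred }.

HB.instance Definition _ := [isSub for dual_fun].
HB.instance Definition _ := [Choice of dual by <:].
HB.instance Definition _ := [SubChoice_isSubLmodule of dual by <:].

Lemma dualP (f g : dual) : f =1 g -> f = g.
Proof. by move=> fg; apply: val_inj; apply/funext. Qed.

Lemma dual_linear (f : dual) : linear f.
Proof. by have /asboolP[] := dual_funP f. Qed.

HB.instance Definition _ (f : dual) :=
  GRing.isLinear.Build R V R^o _ (dual_fun f) (dual_linear f).

Lemma dual_continuous (f : dual) : continuous f.
Proof. by have /asboolP[] := dual_funP f. Qed.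

Definition dual_norm (f : dual) : R := sup [set `|f x| | x in unit_ball V].

Lemma dual_norm_has_sup (f : dual) :
  has_sup [set `|f x| | x in unit_ball V].
Proof.
split; first by exists `|f 0|, 0 => //; rewrite /unit_ball/= normr0.
have [_ /(_ (@dual_continuous f))] := linear_bounded_continuous f.
move=> /linear_boundedP[M [_ /(_ (`|M| + 1))]].
rewrite (le_lt_trans (ler_norm _)) ?ltrDl// => /(_ isT) fM.
exists (`|M| + 1) => _ [x x1 <-]; apply: le_trans (fM x) _.
by rewrite ler_piMr.
Qed.

Lemma dual_norm_ball (f : dual) x : `|x| <= 1 -> `|f x| <= dual_norm f.
Proof.
by move=> x1; apply: ub_le_sup; [have [] := dual_norm_has_sup f|exists x].
Qed.

Lemma dual_norm_le (f : dual) (M : R) :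
  (forall x, `|x| <= 1 -> `|f x| <= M) -> dual_norm f <= M.
Proof.
move=> fM; apply: ge_sup; first by have [] := dual_norm_has_sup f.
by move=> _ [x x1 <-]; exact: fM.
Qed.

Lemma dual_norm_apply (f : dual) x : `|f x| <= dual_norm f * `|x|.
Proof.
have [->|x0] := eqVneq x 0; first by rewrite linear0 !normr0 mulr0.
have nx : 0 < `|x| by rewrite normr_gt0.
rewrite -ler_pdivrMr// mulrC -[X in X * _]ger0_norm ?invr_ge0// -normrZ.
rewrite -linearZ; apply: dual_norm_ball.
by rewrite normrZ ger0_norm ?invr_ge0// mulVf ?gt_eqF.
Qed.

Fact dual_norm_triangle f g : dual_norm (f + g) <= dual_norm f + dual_norm g.
Proof.
apply: dual_norm_le => x x1; apply: le_trans (ler_normD _ _) _.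
by apply: lerD; exact: dual_norm_ball.
Qed.

Fact dual_norm_scale a f : dual_norm (a *: f) = `|a| * dual_norm f.
Proof.
apply/eqP; rewrite eq_le; apply/andP; split.
  apply: dual_norm_le => x x1; rewrite [_ x]/(a *: f x) normrZ.
  by rewrite ler_wpM2l// dual_norm_ball.
have [->|a0] := eqVneq a 0.
  rewrite normr0 mul0r; apply: le_trans (dual_norm_ball (x := 0) _ _) => //.
  by rewrite normr0.
rewrite -ler_pdivlMl ?normr_gt0//; apply: dual_norm_le => x x1.
rewrite ler_pdivlMl ?normr_gt0// -normrZ.
exact: (dual_norm_ball (a *: f)).
Qed.

Fact dual_norm_eq0 f : dual_norm f = 0 -> f = 0.
Proof.
move=> f0; apply: dualP => x; apply/eqP; rewrite -normr_le0.
by rewrite (le_trans (dual_norm_apply _ _))// f0 mul0r.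
Qed.

HB.instance Definition _ := Lmodule_isNormed.Build R dual
  dual_norm_triangle dual_norm_scale dual_norm_eq0.

(* [dual] itself carries the norm topology; [weak_star] is the same type with
   the topology of pointwise convergence on the predual [V]. *)
Definition weak_star : Type :=
  initial_topology (fun f : dual => (f : {ptws V -> R^o})).

HB.instance Definition _ := Topological.on weak_star.

Definition weak_star_cvg (u : nat -> dual) (l : dual) :=
  (u : nat -> weak_star) @ \oo --> (l : weak_star).

Lemma weak_star_cvgP (u : nat -> dual) (l : dual) :
  weak_star_cvg u l <-> forall x, u k x @[k --> \oo] --> l x.
Proof.
rewrite /weak_star_cvg; split=> [ul x|ul].
  have : ((fun f : dual => (f : {ptws V -> R^o})) \o u) @ \oo -->
      (l : {ptws V -> R^o}).
    apply: (@continuous_cvg _ weak_star {ptws V -> R^o} _ _ u _ l _ ul).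
    exact: initial_continuous.
  by move/(pointwise_cvgP _ _).1/(_ x).
have ptl : ((fun f : dual => (f : {ptws V -> R^o})) \o u) @ \oo -->
    (l : {ptws V -> R^o}).
  by apply/(pointwise_cvgP _ _).2 => x; exact: ul.
move=> A [B [[C oC <-] Cl] CA].
have : nbhs (l : {ptws V -> R^o}) C by exact: open_nbhs_nbhs.
move=> /ptl Ck; rewrite nbhs_filterE.
exact: (@filterS _ \oo _ _ _ (fun k => CA (u k)) Ck).
Qed.

End dual_space.

Arguments dual_pred {R} V.

Section direct_sum.
Context {R : realType} {n : nat} (X : 'I_n -> completeNormedModType R).

Definition dsum : Type := forall i, X i.

HB.instance Definition _ := gen_eqMixin dsum.
HB.instance Definition _ := gen_choiceMixin dsum.

Let zero : dsum := fun=> 0.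
Let opp (w : dsum) : dsum := fun i => - w i.
Let add (w z : dsum) : dsum := fun i => w i + z i.
Let scale (a : R) (w : dsum) : dsum := fun i => a *: w i.

Let addA : associative add.
Proof. by move=> x y z; apply/functional_extensionality_dep => i; exact: addrA. Qed.
Let addC : commutative add.
Proof. by move=> x y; apply/functional_extensionality_dep => i; exact: addrC. Qed.
Let add0 : left_id zero add.
Proof. by move=> x; apply/functional_extensionality_dep => i; exact: add0r. Qed.
Let addN : left_inverse zero opp add.
Proof. by move=> x; apply/functional_extensionality_dep => i; exact: addNr. Qed.

HB.instance Definition _ := GRing.isZmodule.Build dsum addA addC add0 addN.

Let scaleA a b (x : dsum) : scale a (scale b x) = scale (a * b) x.
Proof. by apply/functional_extensionality_dep => i; exact: scalerA. Qed.
Let scale1 : left_id 1 scale.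
Proof. by move=> x; apply/functional_extensionality_dep => i; exact: scale1r. Qed.
Let scaleDr : right_distributive scale +%R.
Proof. by move=> a x y; apply/functional_extensionality_dep => i; exact: scalerDr. Qed.
Let scaleDl (x : dsum) : {morph scale^~ x : a b / a + b}.
Proof. by move=> a b; apply/functional_extensionality_dep => i; exact: scalerDl. Qed.

HB.instance Definition _ := GRing.Zmodule_isLmodule.Build R dsum
  scaleA scale1 scaleDr scaleDl.

Definition dsum_norm (w : dsum) : R := \sum_i `|w i|.

Let norm_triangle (w z : dsum) : dsum_norm (w + z) <= dsum_norm w + dsum_norm z.
Proof. by rewrite -big_split ler_sum// => i _; exact: ler_normD. Qed.
Let norm_scale a (w : dsum) : dsum_norm (a *: w) = `|a| * dsum_norm w.
Proof. by rewrite mulr_sumr; apply: eq_bigr => i _; exact: normrZ. Qed.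
Let norm_eq0 (w : dsum) : dsum_norm w = 0 -> w = 0.
Proof.
move=> /eqP; rewrite psumr_eq0// => /allP w0.
apply/functional_extensionality_dep => i; apply/eqP.
by have := w0 i (mem_index_enum i); rewrite /= normr_eq0.
Qed.

HB.instance Definition _ := Lmodule_isNormed.Build R dsum
  norm_triangle norm_scale norm_eq0.

Lemma dsum_sumE (I : Type) (r : seq I) (F : I -> dsum) j :
  (\sum_(i <- r) F i) j = \sum_(i <- r) F i j.
Proof. by elim/big_rec2: _ => // i y z _ <-. Qed.

Definition dsum_inj i (x : X i) : dsum :=
  @eqtype.dfwith 'I_n X (0 : dsum) i x.

Lemma dsum_injE i (x : X i) : dsum_inj x i = x.
Proof. exact: dfwith_in. Qed.

Lemma dsum_inj_neq i (x : X i) j : i != j -> dsum_inj x j = 0.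
Proof. exact: dfwith_out. Qed.

Lemma dsum_inj_linear i : linear (@dsum_inj i).
Proof.
move=> a x y; apply/functional_extensionality_dep => j.
rewrite [RHS]/(a *: dsum_inj x j + dsum_inj y j).
have [ij|ij] := eqVneq i j; first by case: _ / ij; rewrite !dsum_injE.
by rewrite !dsum_inj_neq// scaler0; exact/esym/addr0.
Qed.

HB.instance Definition _ i :=
  GRing.isLinear.Build R (X i) dsum _ (@dsum_inj i) (@dsum_inj_linear i).

Lemma norm_dsum_inj i (x : X i) : `|dsum_inj x| = `|x|.
Proof.
rewrite [LHS]/(dsum_norm (dsum_inj x)) /dsum_norm (bigD1 i)//= dsum_injE big1 ?addr0//.
by move=> j ji; rewrite dsum_inj_neq ?normr0// eq_sym.
Qed.

Lemma dsum_inj_continuous i : continuous (@dsum_inj i).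
Proof.
apply: bounded_linear_continuous; apply/linear_boundedP.
by near=> r => x; rewrite norm_dsum_inj ler_peMl//; near: r; exact: nbhs_pinfty_ge.
Unshelve. all: by end_near. Qed.

Lemma dsum_decomp (w : dsum) : w = \sum_i dsum_inj (w i).
Proof.
apply/functional_extensionality_dep => j; rewrite dsum_sumE (bigD1 j)//=.
by rewrite dsum_injE big1 ?addr0// => i; exact: dsum_inj_neq.
Qed.

Fact dual_comp_subproof (u : dual dsum) i :
  (u \o @dsum_inj i : X i -> R^o) \in dual_pred (X i).
Proof.
apply/asboolP; split; first by move=> a x y; rewrite /= !linearP.
move=> x; apply: continuous_comp; first exact: dsum_inj_continuous.
exact: dual_continuous.
Qed.

(* The component u_i of u under the identification of the dual of the direct
   sum with the direct sum of the duals: restriction to the i-th summand. *)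
Definition dual_comp (u : dual dsum) i : dual (X i) :=
  Dual (dual_comp_subproof u i).

Lemma dual_compE (u : dual dsum) (w : dsum) :
  u w = \sum_i dual_comp u i (w i).
Proof. by rewrite {1}(dsum_decomp w) linear_sum. Qed.

Lemma norm_dual_dsum (u : dual dsum) :
  `|u| = \big[Num.max/0]_i `|dual_comp u i|.
Proof.
apply/eqP; rewrite eq_le; apply/andP; split.
  set M := \big[_/_]_i _.
  apply: dual_norm_le => w w1; rewrite dual_compE.
  have M0 : 0 <= M by exact: bigmax_ge_id.
  apply: le_trans (ler_norm_sum _ _ _) _.
  apply: (@le_trans _ _ (M * \sum_i `|w i|)); last by rewrite ler_piMr.
  rewrite mulr_sumr ler_sum// => i _.
  apply: le_trans (dual_norm_apply _ _) _.
  by rewrite ler_wpM2r//; exact: le_bigmax.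
apply/bigmax_leP; split=> // i _; apply: dual_norm_le => x x1.
by apply: (@dual_norm_ball _ _ u (dsum_inj x)); rewrite norm_dsum_inj.
Qed.

End direct_sum.

(* Main.v *)
Require Import Defs.
From HB Require Import structures.
From mathcomp Require Import all_boot all_order all_algebra.
From mathcomp Require Import all_classical all_reals all_analysis.

Set Implicit Arguments.
Unset Strict Implicit.
Unset Printing Implicit Defensive.
Import Order.TTheory GRing.Theory Num.Theory.
Import numFieldNormedType.Exports.
Local Open Scope classical_set_scope.
Local Open Scope ring_scope.

(** The four conditions follow from one quantitative statement: some ball of
    $Y^*$ lies in the image of a set $D_l = \{u \in D : |u| \le l, |Tu| \le l\}$
    ([nonmeagre_image_ball]).

    Since $T(D)$ is the union of the $T(D_l)$, if it is non-meagre then some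
    $T(D_l)$ is dense in a ball.  Weak-star sequential compactness of balls of
    $X^*$, closedness of $D_l$ and the closed graph make $T(D_l)$
    sequentially weak-star closed ([image_level_set_weak_star_closed]), so it
    is norm closed and contains the whole ball $B(f_0, \varepsilon)$.  It is
    invariant under the isometries $\sigma_k$ of $Y^*$, which move the centre weakly-star
    to 0: for $|f| < \varepsilon$ the points $\sigma_k f_0 + f$ stay in $T(D_l)$
    and converge weakly-star to $f$.  Hence $T(D_l)$ contains a ball around 0.

    The rest is scaling: if $Tu = f$ is solvable with $|u| \le M$ for all
    $|f| \le e$ ([solvable_ball]), then conjugating with $\tau_\lambda$ solves
    it for every $f$ with $|f_j| \le \lambda^{s_j} e$, with
    $|u_i| \le \lambda^{r_i} M$ ([solvable_ball_rescale]).  Large $\lambda$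
    gives surjectivity, small $\lambda$ gives openness at the origin, and
    $\lambda$ proportional to $|f|^{1/s_J}$ or $|f|^{1/s_1}$ gives the two
    power bounds.  Surjectivity gives back non-meagreness by Baire's theorem
    in $Y^*$, as a dual space is complete ([dual_complete]). *)

(** * Baire category *)

Lemma nonmeagre_bigcup (S : topologicalType) (F : nat -> set S) :
  ~ meagre (\bigcup_n F n) -> exists n, interior (closure (F n)) !=set0.
Proof.
move=> nm; apply: contrapT => nF; apply: nm; exists F; split=> // n.
by apply/eqP/negP => /negP/set0P ?; apply: nF; exists n.
Qed.

Lemma complete_not_meagre (R : realType) (U : completeNormedModType R) :
  ~ meagre [set: U].
Proof.
move=> [F [ndF UF]].
have /Baire : forall n, open (~` closure (F n)) /\ dense (~` closure (F n)).
  move=> n; split; first exact/closed_openC/closed_closure.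
  move=> O [x Ox] oO; apply: contrapT => OF.
  suff : interior (closure (F n)) x by rewrite ndF.
  rewrite /interior nbhsE; exists O; first by split.
  by move=> y Oy /=; apply: contrapT => nFy; apply: OF; exists y.
move=> /(_ setT)[||x [_ nFx]]; [by exists point|exact: openT|].
have : [set: U] x by [].
rewrite UF => -[n _ Fnx]; apply: (nFx n) => //; exact: subset_closure.
Qed.

(** * Completeness of the dual *)

(** The limit of a Cauchy filter is its pointwise limit [l]; the Cauchy
    estimate passes to the limit, which shows both that [l] is bounded and that
    the convergence holds in norm. *)
Lemma dual_complete (R : realType) (V : normedModType R)
    (F : set_system (dual V)) : ProperFilter F -> cauchy F -> cvg F.
Proof.
move=> PF /cauchyP cF.
have near_F (e : R) : 0 < e -> exists f0 : dual V,
    F [set f : dual V | forall x, `|f0 x - f x| <= e * `|x|].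
  move=> e0; have [f0 Ff0] := cF e e0; exists f0.
  apply: filterS Ff0 => f; rewrite -ball_normE /= => /ltW f0f x.
  apply: le_trans (dual_norm_apply (f0 - f) x) _.
  by rewrite ler_wpM2r.
have cvg_pt x : cvg (((fun f : dual V => f x) @ F) : set_system R^o).
  apply/cauchy_cvgP/cauchyP => e e0.
  have [f0 /=] := near_F (e / (`|x| + 1)) (divr_gt0 e0 (ltr_wpDl (normr_ge0 x) ltr01)).
  move=> Ff0; exists (f0 x).
  rewrite nbhs_simpl /=.
  apply: filterS Ff0 => f /(_ x) f0f.
  rewrite -ball_normE /=; apply: le_lt_trans f0f _.
  by rewrite mulrAC ltr_pdivrMr ?ltr_wpDl// ltr_pM2l// ltrDl.
pose l x : R^o := lim (((fun f : dual V => f x) @ F) : set_system R^o).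
have l_dist (e : R) : 0 < e -> exists f0 : dual V,
    F [set f : dual V | `|f0 - f| <= e] /\ forall x, `|f0 x - l x| <= e * `|x|.
  move=> e0; have [f0 Ff0] := near_F e e0; exists f0; split.
    apply: filterS Ff0 => f f0f; apply: dual_norm_le => x x1.
    by apply: le_trans (f0f x) _; rewrite ler_piMr// ltW.
  move=> x.
  have cl : (`|f0 x - (f : dual V) x| : R) @[f --> F] --> `|f0 x - l x|.
    apply: cvg_norm; apply: cvgB; [exact: cvg_cst|exact: cvg_pt].
  by apply: (cvgr_to_le cl); apply: filterS Ff0 => f; exact.
have l_linear : linear l.
  move=> a x y; apply: cvg_lim => //.
  under eq_fun do rewrite linearP.
  by apply: cvgD; [apply: cvgZl_tmp|]; exact: cvg_pt.
have l_cont : continuous l.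
  pose L : {linear V -> R^o} := HB.pack l (GRing.isLinear.Build _ _ _ _ l l_linear).
  rewrite -[l]/(L : V -> R^o); apply: bounded_linear_continuous.
  apply/linear_boundedP.
  have [f0 [_ f0l]] := l_dist 1 ltr01.
  near=> M => x; rewrite -[L x](subKr (f0 x)).
  apply: le_trans (ler_normB _ _) _.
  apply: le_trans (lerD (dual_norm_apply f0 x) (f0l x)) _.
  by rewrite -mulrDl ler_wpM2r//; near: M; exact: nbhs_pinfty_ge.
have lP : l \in dual_pred V by apply/asboolP.
apply/cvg_ex; exists (Dual lP); apply/cvgrPdist_le => e e0.
have [f0 [Ff0 f0l]] := l_dist (e / 2) (divr_gt0 e0 (ltr0Sn _ _)).
apply: filterS Ff0 => f f0f.
rewrite (splitr e) -(subrKA f0); apply: le_trans (ler_normD _ _) (lerD _ f0f).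
rewrite distrC; apply: dual_norm_le => x x1; apply: le_trans (f0l x) _.
by rewrite ler_piMr// divr_ge0// ltW.
Unshelve. all: by end_near. Qed.

HB.instance Definition _ (R : realType) (V : normedModType R) :=
  Uniform_isComplete.Build (dual V) (@dual_complete R V).

(** * Weak-star convergence of sequences *)

Lemma weak_star_cvg_norm (R : realType) (V : normedModType R)
    (f_ : nat -> dual V) (f : dual V) : f_ @ \oo --> f -> weak_star_cvg f_ f.
Proof.
move=> f_f; apply/weak_star_cvgP => x; apply/cvgrPdist_le => e e0.
have x1 : 0 < `|x| + 1 by rewrite ltr_wpDl.
move/cvgrPdist_le: f_f => /(_ (e / (`|x| + 1)) (divr_gt0 e0 x1)).
apply: filterS => k fk; apply: le_trans (dual_norm_apply (f - f_ k) x) _.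
apply: (@le_trans _ _ (e / (`|x| + 1) * (`|x| + 1))); last by rewrite divfK// gt_eqF.
by apply: ler_pM; [exact: (normr_ge0 (f - f_ k))| |exact: fk|rewrite lerDl].
Qed.

Lemma cvg_extraction (phi : nat -> nat) :
  {homo phi : i j / (i < j)%N} -> phi @ \oo --> \oo.
Proof.
move=> phi_incr A [N _ NA]; exists N => // k /= Nk; apply: NA => /=.
apply: leq_trans Nk _; elim: k => // k IH.
by apply: leq_ltn_trans IH _; exact: phi_incr.
Qed.

Lemma weak_star_cvg_subseq (R : realType) (V : normedModType R)
    (f_ : nat -> dual V) (f : dual V) (phi : nat -> nat) :
  {homo phi : i j / (i < j)%N} -> weak_star_cvg f_ f ->
  weak_star_cvg (f_ \o phi) f.
Proof. by move=> /cvg_extraction; exact: cvg_comp. Qed.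

Lemma weak_star_bounded_subseq (R : realType) (V : normedModType R)
    (M : R) (u_ : nat -> dual V) :
  seq_compact (weak_star V) (unit_ball (dual V)) ->
  0 < M -> (forall k, `|u_ k| <= M) ->
  exists (phi : nat -> nat) (u : dual V),
    {homo phi : i j / (i < j)%N} /\ weak_star_cvg (u_ \o phi) u.
Proof.
move=> cpt M0 uM; have [k|phi [v [phi_incr _ cv]]] := cpt (fun k => M^-1 *: u_ k).
  by rewrite /unit_ball /= normrZ gtr0_norm ?invr_gt0// ler_pdivrMl// mulr1.
exists phi, (M *: (v : dual V)); split=> //; apply/weak_star_cvgP => x.
have /weak_star_cvgP /(_ x) cvx : weak_star_cvg ((fun k => M^-1 *: u_ k) \o phi) v.
  exact: cv.
rewrite (_ : (fun k => _) = (fun k => M *: ((M^-1 *: u_ (phi k)) x : R^o))).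
  by apply: cvgZl_tmp; exact: cvx.
apply/funext => k /=; rewrite [X in _ = _ *: X]/(M^-1 *: (u_ (phi k) x)).
by rewrite scalerA divff ?scale1r// gt_eqF.
Qed.

(** * Images of level sets under a map with closed graph *)

(** The set $D_l$ of the points of $D$ at which both $u$ and $Tu$ have norm at
    most $l$. *)
Definition level_set (R : realType) (V W : normedModType R) (D : set V)
    (T : V -> W) (l : R) : set V :=
  [set u | [/\ D u, `|u| <= l & `|T u| <= l]].

Section closed_graph.
Context {R : realType} (V W : normedModType R).
Context (D : set (dual V)) (T : dual V -> dual W).
Hypothesis ball_compact : seq_compact (weak_star V) (unit_ball (dual V)).
Hypothesis closed_graph :
  forall (u_ : nat -> dual V) (u : dual V) (f : dual W),
    (forall k, D (u_ k)) -> D u ->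
    weak_star_cvg u_ u -> weak_star_cvg (T \o u_) f -> T u = f.
Hypothesis closed_level : forall l : nat,
  seq_closed (weak_star V) (level_set D T l%:R).

Lemma image_level_set_weak_star_closed (l : nat) (f_ : nat -> dual W)
    (f : dual W) :
  (forall k, (T @` level_set D T l%:R) (f_ k)) -> weak_star_cvg f_ f ->
  (T @` level_set D T l%:R) f.
Proof.
move=> f_T f_f.
have /choice[u_ uP] k : exists u, level_set D T l%:R u /\ T u = f_ k.
  by have [u] := f_T k; exists u.
(* The bound l + 1 is used because the radius has to be positive. *)
have u_l k : `|u_ k| <= l.+1%:R.
  by have [[_ ul _] _] := uP k; rewrite (le_trans ul)// ler_nat.
have [phi [u [phi_incr u_u]]] := weak_star_bounded_subseq ball_compact (ltr0Sn R l) u_l.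
have ul : level_set D T l%:R u.
  by apply: (@closed_level l (u_ \o phi)) u_u => k; have [] := uP (phi k).
exists u => //; case: ul => Du _ _.
apply: (closed_graph (u_ := u_ \o phi)) => // [k|].
  by have [[]] := uP (phi k).
rewrite (_ : T \o _ = f_ \o phi); first exact: weak_star_cvg_subseq.
by apply/funext => k /=; have [] := uP (phi k).
Qed.

Lemma image_level_set_closed (l : nat) : closed (T @` level_set D T l%:R).
Proof.
move=> f clf.
have /choice[f_ f_P] k : exists g,
    (T @` level_set D T l%:R) g /\ `|f - g| < k.+1%:R^-1.
  have k0 : 0 < k.+1%:R^-1 :> R by rewrite invr_gt0.
  have [g [gT fg]] := clf _ (nbhsx_ballx f k.+1%:R^-1 k0).
  by exists g; split=> //; move: fg; rewrite -ball_normE.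
apply: (@image_level_set_weak_star_closed l f_) => [k|]; first by have [] := f_P k.
apply: weak_star_cvg_norm; apply/cvgrPdist_lt => e e0.
near=> k; have [_] := f_P k; move/lt_trans; apply.
near: k; exact: near_infty_natSinv_lt (PosNum e0).
Unshelve. all: by end_near. Qed.

(** The isometries $\sigma_k$ of $D$ and of the target that commute with $T$.
    Of the bijectivity of [sigD k], only that it maps [D] into [D] is needed. *)
Context (sigD : nat -> dual V -> dual V).
Context (sigW : nat -> {linear dual W -> dual W}).
Hypothesis D0 : D 0.
Hypothesis sigD_D : forall k u, D u -> D (sigD k u).
Hypothesis sigD_isom :
  forall k u v, D u -> D v -> `|sigD k u - sigD k v| = `|u - v|.
Hypothesis sigD0 : forall k, sigD k 0 = 0.
Hypothesis sigW_bij : forall k, bijective (sigW k).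
Hypothesis sigW_isom : forall k f, `|sigW k f| = `|f|.
Hypothesis sig_T : forall k u, D u -> T (sigD k u) = sigW k (T u).
Hypothesis sigW_cvg0 : forall f, weak_star_cvg (fun k => sigW k f) 0.

(** The constant sequence $T(0) = T(\sigma_k 0) = \sigma_k T(0)$ converges
    weakly-star to 0. *)
Lemma commuting_fixes0 : T 0 = 0.
Proof.
apply: dualP => x; have /weak_star_cvgP /(_ x) := sigW_cvg0 (T 0).
under eq_fun do rewrite -sig_T// sigD0.
by move=> /(cvg_lim (@norm_hausdorff _ _)); rewrite lim_cst//; exact: norm_hausdorff.
Qed.

(** The image of a level set is invariant under the isometries [sigW k]. *)
Lemma image_level_set_commuting l k f :
  (T @` level_set D T l) f -> (T @` level_set D T l) (sigW k f).
Proof.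
move=> [u [Du ul Tul] <-]; exists (sigD k u); last exact: sig_T.
split; first exact: sigD_D.
  by rewrite -[sigD k u]subr0 -(sigD0 k) sigD_isom// subr0.
by rewrite sig_T// sigW_isom.
Qed.

Lemma nonmeagre_image_ball : ~ meagre (T @` D) ->
  exists (l : nat) (e : R), 0 < e /\
    forall f, `|f| <= e -> (T @` level_set D T l%:R) f.
Proof.
have -> : T @` D = \bigcup_l (T @` level_set D T l%:R).
  apply/seteqP; split=> [_ [u Du <-]|_ [l _ [u [Du _ _] <-]]]; last by exists u.
  have [l ul] : exists l : nat, Num.max `|u| `|T u| <= l%:R.
    exists (Num.truncn (Num.max `|u| `|T u|)).+1; apply/ltW; exact: truncnS_gt.
  exists l => //; exists u => //.
  by split=> //; apply: le_trans ul; rewrite le_max lexx ?orbT.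
move=> /nonmeagre_bigcup[l [f0]].
rewrite -((closure_id _).1 (@image_level_set_closed l)).
move=> /nbhs_ballP[e /= e0 ef0]; exists l, (e / 2); split; first exact: divr_gt0.
move=> f fe.
apply: (@image_level_set_weak_star_closed l (fun k => sigW k f0 + f)).
  (* The preimage of f under sigma_k^Y has the same norm as f, so it is a small
     perturbation of the centre f0, and sigma_k^Y maps the sum to the required
     point. *)
  move=> k; have [sigW' _ sigWK] := sigW_bij k.
  rewrite -(sigWK f) -linearD; apply: image_level_set_commuting; apply: ef0.
  rewrite -ball_normE /= opprD addNKr normrN -(sigW_isom k) sigWK.
  by apply: le_lt_trans fe _; rewrite ltr_pdivrMr// ltr_pMr// ltr1n.
apply/weak_star_cvgP => x; rewrite -[f x]add0r.
have /weak_star_cvgP /(_ x) f0x := sigW_cvg0 f0.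
by apply: cvgD; [exact: f0x|exact: cvg_cst].
Qed.

End closed_graph.

(** * Norms of components *)

Lemma norm_dual_comp_le (R : realType) (n : nat)
    (X : 'I_n -> completeNormedModType R) (u : dual (dsum X)) i :
  `|dual_comp u i| <= `|u|.
Proof. by rewrite norm_dual_dsum; exact: le_bigmax. Qed.

Lemma norm_dual_dsum_le (R : realType) (n : nat)
    (X : 'I_n -> completeNormedModType R) (u : dual (dsum X)) (c : R) :
  0 <= c -> (forall i, `|dual_comp u i| <= c) -> `|u| <= c.
Proof. by move=> c0 uc; rewrite norm_dual_dsum; apply/bigmax_leP. Qed.

Lemma scale_unit_ball (R : realType) (V : normedModType R) (d : R) : 0 < d ->
  [set d *: v | v in unit_ball V] = [set v | `|v| <= d].
Proof.
move=> d0; apply/seteqP; split=> [_ [v v1 <-]|v vd] /=.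
  by rewrite normrZ gtr0_norm// ler_piMr// ltW.
exists (d^-1 *: v); last by rewrite scalerA divff ?scale1r ?gt_eqF.
by rewrite /unit_ball /= normrZ gtr0_norm ?invr_gt0// ler_pdivrMl// mulr1.
Qed.

(** * Real powers *)

Lemma powR_invK (R : realType) (x p : R) :
  0 <= x -> p != 0 -> (x `^ p^-1) `^ p = x.
Proof. by move=> x0 p0; rewrite -powRrM mulVf// powRr1. Qed.

Lemma powR_ge1 (R : realType) (x p : R) : 1 <= x -> 0 <= p -> 1 <= x `^ p.
Proof. by move=> x1 p0; rewrite -(powRr0 x); exact: ler_powR. Qed.

Lemma powR_le1 (R : realType) (x p : R) : 0 < x <= 1 -> 0 <= p -> x `^ p <= 1.
Proof. by move=> x01 p0; rewrite -(powRr0 x); exact: ger_powR. Qed.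

(** * Scaling *)

Section scaling.
Context {R : realType} {m n : nat}.
Context (X : 'I_m.+1 -> completeNormedModType R).
Context (Y : 'I_n.+1 -> completeNormedModType R).
Context (D : set (dual (dsum X))) (T : dual (dsum X) -> dual (dsum Y)).
Context (r : 'I_m.+1 -> R) (s : 'I_n.+1 -> R).
Hypothesis r0 : 0 < r ord0.
Hypothesis r_nd : forall i j : 'I_m.+1, (i <= j)%N -> r i <= r j.
Hypothesis s0 : 0 < s ord0.
Hypothesis s_nd : forall i j : 'I_n.+1, (i <= j)%N -> s i <= s j.
Hypothesis tau : forall l : R, 0 < l ->
    exists (tauD : dual (dsum X) -> dual (dsum X))
           (tauY : dual (dsum Y) -> dual (dsum Y)),
    [/\ set_bij D D tauD,
        bijective tauY,
        forall u, D u -> T (tauD u) = tauY (T u),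
        forall i u, D u ->
          `|dual_comp (tauD u) i| = l `^ r i * `|dual_comp u i| &
        forall j f, `|dual_comp (tauY f) j| = l `^ s j * `|dual_comp f j|].

(** The equation $Tu = f$ has a solution $u \in D$ with $|u| \le M$ for every
    $f$ with $|f| \le e$: the ball of radius $e$ is contained in the image of the
    part of $D$ in the ball of radius $M$. *)
Definition solvable_ball (e M : R) :=
  forall f : dual (dsum Y), `|f| <= e ->
    exists u : dual (dsum X), [/\ D u, T u = f & `|u| <= M].

Let ri_gt0 i : 0 < r i.
Proof. exact: lt_le_trans r0 (@r_nd ord0 i (leq0n i)). Qed.
Let sj_gt0 j : 0 < s j.
Proof. exact: lt_le_trans s0 (@s_nd ord0 j (leq0n j)). Qed.
Let sj_max j : s j <= s ord_max. Proof. by apply: s_nd; exact: leq_ord. Qed.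

(** Conjugation with $\tau_\lambda$, for [l] equal to $\lambda$: the preimage of
    [f] under $\tau_\lambda^{Y^*}$ lies in the ball where the equation is
    solvable, and the solution is mapped by $\tau_\lambda^D$. *)
Lemma solvable_ball_rescale (e M l : R) (f : dual (dsum Y)) :
  solvable_ball e M -> 0 <= e -> 0 < l ->
  (forall j, `|dual_comp f j| <= l `^ s j * e) ->
  exists u : dual (dsum X), [/\ D u, T u = f &
    forall i, `|dual_comp u i| <= l `^ r i * M].
Proof.
move=> eM e0 l0 fe.
have [tauD [tauY [[tauDD _ _] [tauY' _ tauYK] tauT tauDn tauYn]]] := tau l0.
have [|v [Dv Tv vM]] := eM (tauY' f).
  apply: norm_dual_dsum_le => // j; have := fe j.
  by rewrite -{1}(tauYK f) tauYn ler_pM2l// powR_gt0.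
exists (tauD v); split; [exact: tauDD|by rewrite tauT// Tv tauYK|move=> i].
rewrite tauDn// ler_wpM2l ?powR_ge0//; apply: le_trans vM.
exact: norm_dual_comp_le.
Qed.

Lemma solvable_ball_onto (e M : R) :
  0 < e -> solvable_ball e M -> T @` D = setT.
Proof.
move=> e0 eM; apply/seteqP; split=> // f _.
(* As a >= 1, l^(s_j) >= l^(s_1) = a for all j. *)
pose a := Num.max 1 (`|f| / e); pose l := a `^ (s ord0)^-1.
have a1 : 1 <= a by rewrite le_max lexx.
have a0 : 0 < a by exact: lt_le_trans a1.
have l1 : 1 <= l by apply: powR_ge1; rewrite // invr_ge0 ltW.
have [||j|u [Du Tu _]] := @solvable_ball_rescale e M l f eM.
- exact: ltW.
- exact: lt_le_trans l1.
- apply: le_trans (norm_dual_comp_le f j) _; rewrite -ler_pdivrMr//.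
  apply: le_trans (ler_powR l1 (@s_nd ord0 j (leq0n j))).
  by rewrite (powR_invK (ltW a0)) ?(gt_eqF s0)// le_max lexx orbT.
by exists u.
Qed.

Lemma solvable_ball_open (e M : R) : 0 < e -> 0 <= M -> solvable_ball e M ->
  forall e' : R, 0 < e' -> exists2 d, 0 < d & solvable_ball d e'.
Proof.
move=> e0 M0 eM e' e'0.
(* As a <= 1, l^(r_i) <= l^(r_1) = a for all i; M + 1 replaces M, which may be
   0. *)
pose a := Num.min 1 (e' / (M + 1)); pose l := a `^ (r ord0)^-1.
have M1 : 0 < M + 1 by rewrite ltr_wpDl.
have a0 : 0 < a by rewrite lt_min ltr01 divr_gt0.
have a1 : a <= 1 by rewrite ge_min lexx.
have l0 : 0 < l by exact: powR_gt0.
have l1 : l <= 1 by apply: powR_le1; rewrite ?a0// invr_ge0 ltW.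
have l01 : 0 < l <= 1 by rewrite l0.
exists (l `^ s ord_max * e); first by rewrite mulr_gt0// powR_gt0.
move=> f fd; have [||j|u [Du Tu uM]] := @solvable_ball_rescale e M l f eM => //.
- exact: ltW.
- apply: le_trans (norm_dual_comp_le f j) (le_trans fd _).
  by rewrite ler_wpM2r ?(ltW e0)//; exact: ger_powR.
exists u; split=> //; apply: norm_dual_dsum_le => [|i]; first exact: ltW.
apply: le_trans (uM i) _.
apply: (@le_trans _ _ (a * M)).
  rewrite ler_wpM2r// -[leRHS](@powR_invK _ a (r ord0) (ltW a0)) ?(gt_eqF r0)//.
  by apply: ger_powR => //; exact: r_nd.
apply: (@le_trans _ _ (e' / (M + 1) * (M + 1))); last by rewrite divfK// gt_eqF.
apply: ler_pM => //; [exact: ltW|by rewrite ge_min lexx orbT|by rewrite lerDl].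
Qed.

(** The common part of the two power bounds: [p] is $s_J$ when $|f| \le 1$ and
    $s_1$ when $|f| > 1$, which is what the last hypothesis expresses. *)
Lemma solvable_ball_power_bound (e p : R) (f : dual (dsum Y)) :
  0 < e <= 1 -> solvable_ball e 1 -> 0 < p <= s ord_max -> f != 0 ->
  (forall j, `|f| <= `|f| `^ (s j / p)) ->
  exists u : dual (dsum X), [/\ D u, T u = f &
    \sum_i `|dual_comp u i| `^ (p / r i) <=
      m.+1%:R * (e^-1 `^ (s ord0)^-1) `^ s ord_max * `|f|].
Proof.
move=> /andP[e0 e1] eM /andP[p0 pJ] f0 fp.
set c := e^-1 `^ _.
have nf0 : 0 < `|f| by rewrite normr_gt0.
have c1 : 1 <= c by apply: powR_ge1; rewrite ?invf_ge1// invr_ge0 ltW.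
have c0 : 0 < c by exact: lt_le_trans c1.
(* The factor c satisfies c^(s_j) >= 1/e for all j, so that
   l^(s_j) e >= |f|^(s_j/p) >= |f|. *)
pose l := `|f| `^ p^-1 * c.
have l0 : 0 < l by rewrite mulr_gt0// powR_gt0.
have [||j|u [Du Tu uM]] := @solvable_ball_rescale e 1 l f eM => //.
- exact: ltW.
- apply: le_trans (norm_dual_comp_le f j) _.
  rewrite powRM ?powR_ge0 ?(ltW c0)// -powRrM [p^-1 * _]mulrC -mulrA.
  rewrite -[leLHS]mulr1; apply: ler_pM => //.
  rewrite -ler_pdivrMr// div1r -(@powR_invK _ e^-1 (s ord0)) ?invr_ge0 ?(ltW e0) ?(gt_eqF s0)//.
  by apply: ler_powR => //; exact: s_nd.
exists u; split=> //.
apply: (@le_trans _ _ (\sum_(i < m.+1) `|f| * c `^ s ord_max)); last first.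
  by rewrite sumr_const card_ord -[leLHS]mulr_natl -mulrA [_ * `|f|]mulrC.
apply: ler_sum => i _.
apply: (@le_trans _ _ (l `^ p)); last first.
  rewrite powRM ?powR_ge0 ?(ltW c0)// powR_invK ?gt_eqF//.
  by rewrite ler_wpM2l//; exact: ler_powR.
have -> : l `^ p = (l `^ r i) `^ (p / r i).
  by rewrite -powRrM mulrCA divff ?mulr1// gt_eqF.
rewrite ge0_ler_powR ?nnegrE ?powR_ge0 ?divr_ge0 ?(ltW p0) ?(ltW (ri_gt0 i))//.
by rewrite -[leRHS]mulr1.
Qed.

Lemma solvable_ball_two_regime_bound (e : R) :
  D 0 -> T 0 = 0 -> 0 < e <= 1 -> solvable_ball e 1 ->
  exists C : R, forall f : dual (dsum Y), exists u : dual (dsum X),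
    [/\ D u, T u = f,
        `|f| <= 1 ->
          \sum_i `|dual_comp u i| `^ (s ord_max / r i) <= C * `|f| &
        1 < `|f| ->
          \sum_i `|dual_comp u i| `^ (s ord0 / r i) <= C * `|f|].
Proof.
move=> D0 T0 e01 eM.
exists (m.+1%:R * (e^-1 `^ (s ord0)^-1) `^ s ord_max) => f.
have [->|f0] := eqVneq f 0.
  exists 0; rewrite normr0 mulr0 ltr10; split=> // _.
  rewrite big1// => i _; have /eqP-> : `|dual_comp (0 : dual (dsum X)) i| == 0.
    by rewrite -normr_le0 normr_id -[leRHS](@normr0 _ (dual (dsum X))) norm_dual_comp_le.
  by rewrite powR0// gt_eqF// divr_gt0.
have nf0 : 0 < `|f| by rewrite normr_gt0.
have [f1|f1] := leP `|f| 1.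
  have [||j|u [Du Tu uC]] := @solvable_ball_power_bound e (s ord_max) f e01 eM => //.
  - by rewrite sj_gt0 lexx.
  - by apply: ger1_powR; rewrite ?nf0// ler_pdivrMr// mul1r.
  by exists u; split.
have [||j|u [Du Tu uC]] := @solvable_ball_power_bound e (s ord0) f e01 eM => //.
- by rewrite s0 sj_max.
- by apply: le1r_powR; rewrite ?(ltW f1)// ler_pdivlMr// mul1r s_nd.
by exists u; split.
Qed.

End scaling.

(** * The equivalences *)

Theorem theorem5p2 (R : realType) (m n : nat)
    (X : 'I_m.+1 -> completeNormedModType R)
    (Y : 'I_n.+1 -> completeNormedModType R)
    (D : set (dual (dsum X)))
    (T : dual (dsum X) -> dual (dsum Y))
    (r : 'I_m.+1 -> R) (s : 'I_n.+1 -> R) :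
  seq_compact (weak_star (dsum X)) (unit_ball (dual (dsum X))) ->
  D 0 ->
  (forall (u_ : nat -> dual (dsum X)) (u : dual (dsum X)) (f : dual (dsum Y)),
    (forall k, D (u_ k)) -> D u ->
    weak_star_cvg u_ u -> weak_star_cvg (T \o u_) f -> T u = f) ->
  0 < r ord0 -> (forall i j : 'I_m.+1, (i <= j)%N -> r i <= r j) ->
  0 < s ord0 -> (forall i j : 'I_n.+1, (i <= j)%N -> s i <= s j) ->
  (forall l : R, 0 < l ->
    exists (tauD : dual (dsum X) -> dual (dsum X))
           (tauY : dual (dsum Y) -> dual (dsum Y)),
    [/\ set_bij D D tauD,
        bijective tauY,
        forall u, D u -> T (tauD u) = tauY (T u),
        forall i u, D u ->
          `|dual_comp (tauD u) i| = l `^ r i * `|dual_comp u i| &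
        forall j f, `|dual_comp (tauY f) j| = l `^ s j * `|dual_comp f j|]) ->
  (exists (sigD : nat -> dual (dsum X) -> dual (dsum X))
          (sigY : nat -> {linear dual (dsum Y) -> dual (dsum Y)}),
    [/\ forall k, [/\ set_bij D D (sigD k),
          forall u v, D u -> D v -> `|sigD k u - sigD k v| = `|u - v| &
          sigD k 0 = 0],
        forall k, bijective (sigY k) /\ (forall f, `|sigY k f| = `|f|),
        forall k u, D u -> T (sigD k u) = sigY k (T u) &
        forall f, weak_star_cvg (fun k => sigY k f) 0]) ->
  (forall l : nat, seq_closed (weak_star (dsum X))
     [set u : dual (dsum X) | [/\ D u, `|u| <= l%:R & `|T u| <= l%:R]]) ->
  [<-> ~ meagre (T @` D);
       T @` D = setT;
       forall e : R, 0 < e -> exists2 d : R, 0 < d &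
         [set d *: f | f in unit_ball (dual (dsum Y))] `<=`
         T @` (D `&` [set e *: u | u in unit_ball (dual (dsum X))]);
       exists C : R, forall f : dual (dsum Y), exists u : dual (dsum X),
         [/\ D u, T u = f,
             `|f| <= 1 ->
               \sum_i `|dual_comp u i| `^ (s ord_max / r i) <= C * `|f| &
             1 < `|f| ->
               \sum_i `|dual_comp u i| `^ (s ord0 / r i) <= C * `|f|]].
Proof.
move=> ball_compact D0 closed_graph r0 r_nd s0 s_nd tau.
move=> [sigD [sigY [sigD_P sigY_P sig_T sigY_cvg0]]] closed_level.
have sigD_D k u : D u -> D (sigD k u).
  by have [[sigDD _ _] _ _] := sigD_P k; exact: sigDD.
have sigD_isom k u v : D u -> D v -> `|sigD k u - sigD k v| = `|u - v|.
  by have [_ + _] := sigD_P k; exact.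
have sigD0 k : sigD k 0 = 0 by have [] := sigD_P k.
have sigY_bij k : bijective (sigY k) by have [] := sigY_P k.
have sigY_isom k f : `|sigY k f| = `|f| by have [_] := sigY_P k; exact.
have T0 : T 0 = 0 := commuting_fixes0 D0 sigD0 sig_T sigY_cvg0.
have ball : ~ meagre (T @` D) ->
    exists M e : R, [/\ 0 <= M, 0 < e & solvable_ball D T e M].
  move=> /(nonmeagre_image_ball ball_compact closed_graph closed_level D0
    sigD_D sigD_isom sigD0 sigY_bij sigY_isom sig_T sigY_cvg0)[l [e [e0 eP]]].
  exists l%:R, e; split=> // f /eP[u [Du ul _] Tu].
  by exists u.
have onto_nonmeagre : T @` D = setT -> ~ meagre (T @` D).
  by move=> ->; exact: complete_not_meagre.
tfae.
- move=> /ball[M [e [M0 e0 eM]]].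
  exact: (solvable_ball_onto s0 s_nd tau e0 eM).
- move=> /onto_nonmeagre /ball[M [e [M0 e0 eM]]] e' e'0.
  have [d d0 dP] := solvable_ball_open r0 r_nd s_nd tau e0 M0 eM e'0.
  exists d => //; rewrite !scale_unit_ball// => f /dP[u [Du Tu ue]].
  by exists u.
- move=> /(_ 1 ltr01)[d d0]; rewrite !scale_unit_ball// => dT.
  (* A radius at most 1 makes the factor c = (1/e)^(1/s_1) of the power bound at
     least 1, so that its powers increase with the exponent. *)
  apply: (@solvable_ball_two_regime_bound _ _ _ _ _ D T r s r0 r_nd s0 s_nd tau
    (Num.min d 1)) => //.
    by rewrite lt_min d0 ltr01 ge_min lexx orbT.
  move=> f; rewrite le_min => /andP[fd _].
  by have [u [Du u1] Tu] := dT f fd; exists u.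
- move=> [C CP]; apply: onto_nonmeagre; apply/seteqP; split=> // f _.
  by have [u [Du Tu _ _]] := CP f; exists u.
Qed.
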